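(* Assume (H0) and (H1). In addition, let $H$ be semiconcave on $\mathbb{R}^n$ with semiconcavity constant $\theta^{-1}>0$, and let $\sigma$ be semiconvex on $\mathbb{R}^n$ with constant $B>0$. Then there exists $t_*\in(0,T)$ such that for all $t_0\in(0,t_* )$ the function $v(x)=u(t_0,x)$, $x\in\mathbb{R}^n$, is semiconvex, where $u(t,x)=\min_{y\in\mathbb{R}^n}\{\sigma(y)+tH^*(\frac{x-y}{t})\}$.
   Context: Let $T>0$, $\Omega=(0,T)\times\mathbb{R}^n$, $H:\mathbb{R}^n\to\mathbb{R}$, $\sigma:\mathbb{R}^n\to\mathbb{R}$. $H^*(z)=\max_{y\in\mathbb{R}^n}\{\langle z,y\rangle-H(y)\}$ is the Fenchel conjugate of $H$. (H0): $H$ is strictly convex on $\mathbb{R}^n$ and superlinear, i.e. $\lim_{\|p\|\to\infty}H(p)/\|p\|=+\infty$. (H1): $\sigma$ is continuous on $\mathbb{R}^n$ and for every $(t_0,x_0)\in[0,T)\times\mathbb{R}^n$ there exist constants $r,N>0$ such that $\min_{\|y\|\le N}\{\sigma(y)+tH^*(\frac{x-y}{t})\}<\sigma(z)+tH^*(\frac{x-z}{t})$ whenever $\|z\|>N$, $t\in(0,T)$ and $|t-t_0|+\|x-x_0\|<r$. A continuous function $v:\mathcal{O}\to\mathbb{R}$ on a convex set $\mathcal{O}\subset\mathbb{R}^m$ is semiconcave (with linear modulus) with semiconcavity constant $C>0$ if $\lambda v(y_1)+(1-\lambda)v(y_2)-v(\lambda y_1+(1-\lambda)y_2)\le\lambda(1-\lambda)\frac{C}{2}|y_1-y_2|^2$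 for all $y_1,y_2\in\mathcal{O}$ and $\lambda\in[0,1]$. It is semiconcave if this holds for some $C>0$. $v$ is semiconvex (with constant $C$) if $-v$ is semiconcave (with constant $C$). *)

(* Defs.v *)
From HB Require Import structures.
From mathcomp Require Import all_boot all_order all_algebra.
From mathcomp Require Import all_classical all_reals all_analysis.

Set Implicit Arguments.
Unset Strict Implicit.
Unset Printing Implicit Defensive.

Import Order.TTheory GRing.Theory Num.Theory.
Import numFieldNormedType.Exports.

Local Open Scope classical_set_scope.
Local Open Scope ring_scope.

(* The norm [`|x|] that MathComp-Analysis puts on ['rV[R]_n] is the sup norm,
   whence an explicit Euclidean norm. It induces the same topology, so
   [continuous] has its usual meaning on ['rV[R]_n]. *)
Definition dot (R : realType) (n : nat) (x y : 'rV[R]_n) : R :=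
  \sum_(i < n) x 0 i * y 0 i.

Definition enorm (R : realType) (n : nat) (x : 'rV[R]_n) : R :=
  Num.sqrt (dot x x).

(* Attained extrema: an element of [A] bounding [A]. The value is 0 when there
   is no such element. *)
Definition set_max (R : realType) (A : set R) : R := xget 0 (A `&` ubound A).

Definition set_min (R : realType) (A : set R) : R := xget 0 (A `&` lbound A).

Lemma set_maxE (R : realType) (A : set R) (m : R) :
  A m -> ubound A m -> set_max A = m.
Proof.
move=> Am ubm; apply: xget_unique => // y [Ay uby].
by apply/le_anti; rewrite ubm// uby.
Qed.

Lemma set_minE (R : realType) (A : set R) (m : R) :
  A m -> lbound A m -> set_min A = m.
Proof.
move=> Am lbm; apply: xget_unique => // y [Ay lby].
by apply/le_anti; rewrite lbm// lby.
Qed.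

Definition fenchel (R : realType) (n : nat) (H : 'rV[R]_n -> R)
    (z : 'rV[R]_n) : R :=
  set_max (range (fun y => dot z y - H y)).

Definition hopf_cost (R : realType) (n : nat) (H sigma : 'rV[R]_n -> R)
    (t : R) (x y : 'rV[R]_n) : R :=
  sigma y + t * fenchel H (t^-1 *: (x - y)).

(* Only meant for [0 < t]. *)
Definition hopf_lax (R : realType) (n : nat) (H sigma : 'rV[R]_n -> R)
    (t : R) (x : 'rV[R]_n) : R :=
  set_min (range (hopf_cost H sigma t x)).

Definition strictly_convex (R : realType) (n : nat) (H : 'rV[R]_n -> R) : Prop :=
  forall (x y : 'rV[R]_n) (l : R), x != y -> 0 < l < 1 ->
    H (l *: x + (1 - l) *: y) < l * H x + (1 - l) * H y.

Definition superlinear (R : realType) (n : nat) (H : 'rV[R]_n -> R) : Prop :=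
  forall K : R, exists M : R, forall p : 'rV[R]_n,
    M < enorm p -> K < H p / enorm p.

Definition condH0 (R : realType) (n : nat) (H : 'rV[R]_n -> R) : Prop :=
  strictly_convex H /\ superlinear H.

Definition condH1 (R : realType) (n : nat) (T : R)
    (H sigma : 'rV[R]_n -> R) : Prop :=
  continuous sigma /\
  forall (t0 : R) (x0 : 'rV[R]_n), 0 <= t0 < T ->
    exists r N : R, [/\ 0 < r, 0 < N &
      forall (t : R) (x z : 'rV[R]_n),
        N < enorm z -> 0 < t < T -> `|t - t0| + enorm (x - x0) < r ->
        set_min [set hopf_cost H sigma t x y | y in [set y | enorm y <= N]]
          < hopf_cost H sigma t x z].

Definition semiconcave_with (R : realType) (m : nat) (O : set 'rV[R]_m)
    (v : 'rV[R]_m -> R) (C : R) : Prop :=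
  [/\ convex_set O, {within O, continuous v}, 0 < C &
    forall (y1 y2 : 'rV[R]_m) (l : R), O y1 -> O y2 -> 0 <= l <= 1 ->
      l * v y1 + (1 - l) * v y2 - v (l *: y1 + (1 - l) *: y2)
        <= l * (1 - l) * (C / 2) * enorm (y1 - y2) ^+ 2].

Definition semiconvex_with (R : realType) (m : nat) (O : set 'rV[R]_m)
    (v : 'rV[R]_m -> R) (C : R) : Prop :=
  semiconcave_with O (fun x => - v x) C.

Definition semiconvex (R : realType) (m : nat) (O : set 'rV[R]_m)
    (v : 'rV[R]_m -> R) : Prop :=
  exists C : R, semiconvex_with O v C.

(* Main.v *)
Require Import Defs.
From HB Require Import structures.
From mathcomp Require Import all_boot all_order all_algebra.
From mathcomp Require Import all_classical all_reals all_analysis.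
From mathcomp Require Import ring lra.

Import Order.TTheory GRing.Theory Num.Theory.
Import numFieldNormedType.Exports.

Local Open Scope classical_set_scope.
Local Open Scope ring_scope.

(** Write [a = theta / t] and let [F x y = sigma y + t * H^*((x - y) / t)] be
    the cost whose minimum over [y] is [u (t, x)].

    Semiconcavity of [H] with constant [theta^-1] dualizes into uniform
    convexity of its conjugate [H^*] with modulus [theta]
    ([fenchel_uniformly_convex]), so the kinetic term [t * H^*(. / t)] is
    uniformly convex with modulus [a]. Hence, for the pairs [(x1, y1)] and
    [(x2, y2)], the convexity gap of the joint function [F] is at least
    [l (1 - l) / 2] times [a |xi - eta|^2 - B |eta|^2], where [xi = x1 - x2]
    and [eta = y1 - y2]: the second term is what the semiconvexity of [sigma]
    may lose. As long as [B < a], that is [t < theta / B], this quadratic form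
    is bounded below by [- (a B / (a - B)) |xi|^2], uniformly in [eta]
    ([quadratic_gap]). Choosing for [y1] and [y2] minimizers of [F x1] and
    [F x2], and testing the minimum at the intermediate point with the
    corresponding combination of [y1] and [y2], gives semiconvexity of
    [u (t, .)] with constant [a B / (a - B)].

    The extrema involved have to be attained, and semiconvexity includes
    continuity. Superlinearity of [H] bounds the maximizers in the definition
    of [H^* z] uniformly for [z] in a ball ([fenchel_maximizer_bounded]); since
    [H^*] is a supremum of affine functions whose slopes are the competing
    points, this makes [H^*] locally Lipschitz. The compactness condition on
    [sigma] plays the same role for the minimizers in [u (t, x)]
    ([hopf_minimizer_locally_bounded]), and the local Lipschitz bound on [H^*]
    then passes to [u (t, .)] ([continuous_hopf_lax]). *)

(** * Euclidean structure on row vectors *)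

Section Euclidean.
Context {R : realType} {n : nat}.
Implicit Types (x y z : 'rV[R]_n) (a : R).

Lemma dotC x y : dot x y = dot y x.
Proof. by apply: eq_bigr => i _; rewrite mulrC. Qed.

Lemma dotDl x y z : dot (x + y) z = dot x z + dot y z.
Proof. by rewrite -big_split; apply: eq_bigr => i _; rewrite mxE mulrDl. Qed.

Lemma dotZl a x y : dot (a *: x) y = a * dot x y.
Proof. by rewrite /dot mulr_sumr; apply: eq_bigr => i _; rewrite mxE mulrA. Qed.

Lemma dotNl x y : dot (- x) y = - dot x y.
Proof. by rewrite -scaleN1r dotZl mulN1r. Qed.

Lemma dotDr x y z : dot z (x + y) = dot z x + dot z y.
Proof. by rewrite dotC dotDl !(dotC z). Qed.

Lemma dotZr a x y : dot y (a *: x) = a * dot y x.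
Proof. by rewrite dotC dotZl (dotC y). Qed.

Lemma dotNr x y : dot y (- x) = - dot y x.
Proof. by rewrite dotC dotNl (dotC y). Qed.

Definition dotE := (dotDl, dotDr, dotNl, dotNr, dotZl, dotZr).

Lemma dot_ge0 x : 0 <= dot x x.
Proof. by apply: sumr_ge0 => i _; rewrite -expr2 sqr_ge0. Qed.

Lemma sqr_enorm x : enorm x ^+ 2 = dot x x.
Proof. by rewrite sqr_sqrtr// dot_ge0. Qed.

Lemma enorm_ge0 x : 0 <= enorm x.
Proof. exact: sqrtr_ge0. Qed.

Lemma enormZ a x : enorm (a *: x) = `|a| * enorm x.
Proof. by rewrite /enorm !dotE mulrA -expr2 sqrtrM ?sqr_ge0// sqrtr_sqr. Qed.

Lemma enormN x : enorm (- x) = enorm x.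
Proof. by rewrite -scaleN1r enormZ normrN1 mul1r. Qed.

Lemma enorm0 : enorm (0 : 'rV[R]_n) = 0.
Proof. by rewrite -(scale0r (0 : 'rV[R]_n)) enormZ normr0 mul0r. Qed.

Lemma coord_le_enorm x (i : 'I_n) : `|x 0 i| <= enorm x.
Proof.
rewrite -sqrtr_sqr ler_wsqrtr// /dot (bigD1 i)//= expr2 lerDl.
by apply: sumr_ge0 => j _; rewrite -expr2 sqr_ge0.
Qed.

Lemma enorm_eq0 x : enorm x = 0 -> x = 0.
Proof.
move=> x0; apply/rowP => i; rewrite mxE; apply/normr0_eq0/le_anti.
by rewrite normr_ge0 -[leRHS]x0 coord_le_enorm.
Qed.

(** Cauchy-Schwarz, from the nonnegativity of the squared norm of
    [enorm y *: x - enorm x *: y]. *)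
Lemma dot_le_enorm x y : dot x y <= enorm x * enorm y.
Proof.
have [x0|x0] := eqVneq (enorm x) 0.
  by rewrite x0 mul0r (enorm_eq0 _ x0) -(scale0r (0 : 'rV[R]_n)) dotZl mul0r.
have [y0|y0] := eqVneq (enorm y) 0.
  by rewrite y0 mulr0 (enorm_eq0 _ y0) -(scale0r (0 : 'rV[R]_n)) dotZr mul0r.
have xy0 : 0 < enorm x * enorm y by rewrite mulr_gt0// lt0r enorm_ge0 ?x0 ?y0.
have := dot_ge0 (enorm y *: x - enorm x *: y).
rewrite !dotE (dotC y x) -!sqr_enorm => h.
rewrite -(ler_pM2l xy0); nra.
Qed.

Lemma enorm_triangle x y : enorm (x + y) <= enorm x + enorm y.
Proof.
rewrite -(@ler_pXn2r _ 2)// ?nnegrE ?addr_ge0 ?enorm_ge0//.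
rewrite sqr_enorm !dotE (dotC y x) -!sqr_enorm.
have := dot_le_enorm x y; nra.
Qed.

Lemma continuous_dot_diag : continuous (fun x : 'rV[R]_n => dot x x).
Proof.
move=> x; apply: cvg_big => [||i _].
- exact: add_continuous.
- exact: nbhs_filter.
- exact: (cvgM (FF := nbhs_filter x) (@coord_continuous R 1 n 0 i x)
    (@coord_continuous R 1 n 0 i x)).
Qed.

Lemma continuous_dotr z : continuous (fun x : 'rV[R]_n => dot z x).
Proof.
move=> x; apply: cvg_big => [||i _].
- exact: add_continuous.
- exact: nbhs_filter.
- exact: (cvgM (FF := nbhs_filter x) (cvg_cst (FF := nbhs_filter x) (z 0 i))
    (@coord_continuous R 1 n 0 i x)).
Qed.

Lemma continuous_enorm : continuous (@enorm R n).
Proof.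
move=> x; rewrite /enorm.
have h := @continuous_comp _ _ _ (fun x => dot x x) (@Num.sqrt R) x
  (@continuous_dot_diag x) (@sqrt_continuous _ _).
exact: h.
Qed.

(** The sup norm, which defines boundedness here, is at most the Euclidean
    norm, and the latter is continuous: Heine-Borel applies. *)
Lemma compact_eball (M : R) : compact [set x : 'rV[R]_n | enorm x <= M].
Proof.
apply: bounded_closed_compact; last first.
  apply: (@preimage_closed _ _ (@enorm R n) [set r | r <= M]).
    by move=> x _; exact: continuous_enorm.
  exact: closed_le.
exists M; split; first exact: num_real.
move=> r /ltW Mr x /= xM.
rewrite [leLHS]/Num.Def.normr/= mx_normrE.
apply: bigmax_le => [|[i j] _ /=].
  exact: le_trans (enorm_ge0 x) (le_trans xM Mr).
by rewrite ord1 (le_trans (coord_le_enorm x j))// (le_trans xM).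
Qed.

Lemma enorm_near x (e : R) : 0 < e -> \forall y \near x, enorm (y - x) < e.
Proof.
move=> e0.
have sx : {for x, continuous (fun y => y - x)}.
  exact: (cvgB (FF := nbhs_filter x) cvg_id (cvg_cst (FF := nbhs_filter x) x)).
have h := @continuous_comp _ _ _ (fun y => y - x) (@enorm R n) x sx
  (@continuous_enorm _).
apply: (h [set r | r < e]); rewrite /= subrr enorm0.
exact: lt_nbhsl.
Qed.

Lemma continuous_locally_lipschitz (f : 'rV[R]_n -> R) :
  (forall x, exists r L : R, 0 < r /\
    forall y, enorm (y - x) < r -> `|f y - f x| <= L * enorm (y - x)) ->
  continuous f.
Proof.
move=> lipf x; have [r [L [r0 lip]]] := lipf x.
apply/(@cvgrPdist_lt _ _ _ _ (nbhs_filter x)) => e e0.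
have L0 : 0 < `|L| + 1 by rewrite ltr_wpDl.
have N := @filterI _ _ (nbhs_filter x) _ _ (enorm_near x _ r0)
  (enorm_near x _ (divr_gt0 e0 L0)).
apply: (@filterS _ _ (nbhs_filter x) _ _ _ N) => y [/= yr ye].
rewrite distrC (le_lt_trans (lip _ yr))//.
rewrite ltr_pdivlMr// in ye; apply: le_lt_trans ye.
rewrite mulrC ler_wpM2l ?enorm_ge0//.
by rewrite (le_trans (ler_norm L))// lerDl.
Qed.

(** Completing the square: the difference of the two sides is
    [(a - b)^-1 * enorm (a *: xi - (a - b) *: eta) ^+ 2]. This is where the
    smallness of time enters, and the constant on the left is optimal, being
    reached at [eta = (a / (a - b)) *: xi]. *)
Lemma quadratic_gap (a b : R) (xi eta : 'rV[R]_n) : b < a ->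
  - (a * b / (a - b)) * enorm xi ^+ 2
    <= a * enorm (xi - eta) ^+ 2 - b * enorm eta ^+ 2.
Proof.
move=> ba; have ab0 : 0 < a - b by rewrite subr_gt0.
rewrite -subr_ge0.
suff -> : a * enorm (xi - eta) ^+ 2 - b * enorm eta ^+ 2
    - - (a * b / (a - b)) * enorm xi ^+ 2
  = (a - b)^-1 * enorm (a *: xi - (a - b) *: eta) ^+ 2.
  by rewrite mulr_ge0 ?invr_ge0 ?sqr_ge0// ltW.
by rewrite !sqr_enorm !dotE (dotC eta xi); field; rewrite gt_eqF.
Qed.

End Euclidean.

(** * The Fenchel conjugate of a superlinear semiconcave function *)

Section Fenchel.
Context {R : realType} {n : nat}.
Variable H : 'rV[R]_n -> R.
Implicit Types (x y z w : 'rV[R]_n).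

Definition fenchel_maximizer z y :=
  forall w, dot z w - H w <= dot z y - H y.

Lemma fenchel_maximizerE z y :
  fenchel_maximizer z y -> fenchel H z = dot z y - H y.
Proof. by move=> hy; apply: set_maxE => [|_ [w _ <-]]; [exists y|exact: hy]. Qed.

Hypotheses (cH : continuous H) (sH : superlinear H).

(** Outside a large ball [H w] exceeds [(|rho| + |H 0| + 1) * enorm w], so
    [dot z w - H w] is below [- H 0], its value at [w = 0]; inside the ball the
    maximum exists by compactness. The radius depends on [z] only through the
    bound [rho], which is what gives a local Lipschitz constant for the
    conjugate. *)
Lemma fenchel_maximizer_bounded (rho : R) :
  exists L : R, forall z, enorm z <= rho ->
    exists y, enorm y <= L /\ fenchel_maximizer z y.
Proof.
have [M HM] := sH (`|rho| + `|H 0| + 1).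
pose L := Num.max M 1.
have L1 : 1 <= L by rewrite le_max lexx orbT.
exists L => z zr.
have [||y yL ymax] := EVT_max_rV _ (compact_eball L)
    (f := fun y => dot z y - H y).
- by exists 0 => /=; rewrite enorm0 (le_trans _ L1).
- apply: continuous_subspaceT => y.
  exact: (cvgB (FF := nbhs_filter y) (@continuous_dotr R n z y) (cH y)).
rewrite inE /= in yL.
exists y; split => // w.
have [wL|Lw] := leP (enorm w) L; first by apply: ymax; rewrite inE.
have w1 : 1 < enorm w by exact: le_lt_trans Lw.
apply: (@le_trans _ _ (dot z 0 - H 0)); last first.
  by apply: ymax; rewrite inE /= enorm0 (le_trans _ L1).
have Mw : M < enorm w by apply: le_lt_trans Lw; rewrite le_max lexx.
have := HM w Mw; rewrite ltr_pdivlMr ?(lt_trans _ w1)// => Hw.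
have zw := dot_le_enorm z w.
have -> : dot z 0 = 0 by rewrite -(scale0r (0 : 'rV[R]_n)) dotZr mul0r.
have := ler_norm (H 0); have := normr_ge0 (H 0); have := ler_norm rho.
have := enorm_ge0 z.
move: zr zw Hw w1; move: (dot z w) (enorm z) (enorm w) (H w) (H 0) => a b c d e.
move: (`|rho|) (`|e|) => p q br abc Hd c1 b0 rp q0 eq.
have : b * c <= p * c by rewrite ler_wpM2r//; lra.
have : q <= q * c by rewrite ler_peMr// ltW.
lra.
Qed.

Lemma fenchel_ge z w : dot z w - H w <= fenchel H z.
Proof.
have [L /(_ z (lexx _)) [y [_ hy]]] := fenchel_maximizer_bounded (enorm z).
by rewrite (fenchel_maximizerE _ _ hy).
Qed.

(** A maximizer [y] for [z] competes in the maximum for [w], and the loss is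
    [dot (z - w) y], where [enorm y] is bounded by [fenchel_maximizer_bounded]. *)
Lemma fenchel_lipschitz (rho : R) :
  exists L : R, forall z w, enorm z <= rho ->
    fenchel H z - fenchel H w <= L * enorm (z - w).
Proof.
have [L hL] := fenchel_maximizer_bounded rho.
exists L => z w /hL[y [yL hy]].
rewrite (fenchel_maximizerE _ _ hy).
have := fenchel_ge w y.
have := dot_le_enorm (z - w) y; rewrite !dotE.
have := ler_wpM2l (enorm_ge0 (z - w)) yL.
rewrite [L * _]mulrC; lra.
Qed.

Lemma continuous_fenchel : continuous (fenchel H).
Proof.
apply: continuous_locally_lipschitz => x.
have [L hL] := fenchel_lipschitz (enorm x + 1).
exists 1, L; split => // y yx1.
rewrite ler_norml; apply/andP; split.
  rewrite lerNl opprB -enormN opprB hL// lerDl//.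
rewrite hL// -{1}(subrKC x y) (le_trans (enorm_triangle _ _))//.
by rewrite lerD2l ltW.
Qed.

(** Let [y] be a maximizer at the intermediate point. The maxima at [z1] and
    [z2] are tested at [y + (1 - l) *: d] and [y - l *: d], whose combination is
    [y]; the displacement gains [l (1 - l) dot (z1 - z2) d] in the linear terms
    and costs at most [l (1 - l) |d|^2 / (2 theta)] by semiconcavity of [H].
    The choice [d = theta *: (z1 - z2)] maximizes the net gain. *)
Lemma fenchel_uniformly_convex (theta : R) :
  0 < theta -> semiconcave_with [set: 'rV[R]_n] H theta^-1 ->
  forall z1 z2 (l : R), 0 <= l <= 1 ->
    fenchel H (l *: z1 + (1 - l) *: z2)
      + l * (1 - l) * (theta / 2) * enorm (z1 - z2) ^+ 2
    <= l * fenchel H z1 + (1 - l) * fenchel H z2.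
Proof.
move=> t0 [_ _ _ Hsc] z1 z2 l l01.
set z := l *: z1 + _.
have [L /(_ z (lexx _)) [y [_ hy]]] := fenchel_maximizer_bounded (enorm z).
rewrite (fenchel_maximizerE _ _ hy).
pose d := theta *: (z1 - z2).
have := Hsc (y + (1 - l) *: d) (y - l *: d) l I I l01.
have -> : l *: (y + (1 - l) *: d) + (1 - l) *: (y - l *: d) = y.
  by apply/rowP => i; rewrite !mxE; ring.
have -> : y + (1 - l) *: d - (y - l *: d) = d.
  by apply/rowP => i; rewrite !mxE; ring.
rewrite enormZ exprMn (gtr0_norm t0) => Hyd.
have /andP[l0 l1] := l01.
have f1 := ler_wpM2l l0 (fenchel_ge z1 (y + (1 - l) *: d)).
have f2 : _ <= _ :=
  ler_wpM2l (_ : 0 <= 1 - l) (fenchel_ge z2 (y - l *: d)).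
have {}f2 := f2 ltac:(lra).
have E : theta^-1 / 2 * theta ^+ 2 = theta / 2 by field; rewrite gt_eqF.
have Hyd' : l * H (y + (1 - l) *: d) + (1 - l) * H (y - l *: d) - H y
   <= l * (1 - l) * (theta / 2) * enorm (z1 - z2) ^+ 2.
  by apply: le_trans Hyd _; rewrite -E le_eqVlt; apply/orP; left; apply/eqP; ring.
have D : l * dot z1 (y + (1 - l) *: d) + (1 - l) * dot z2 (y - l *: d)
   = dot z y + l * (1 - l) * theta * enorm (z1 - z2) ^+ 2.
  by rewrite sqr_enorm /z /d !dotE (dotC z2 z1); ring.
rewrite !mulrBr in f1 f2; lra.
Qed.

End Fenchel.

(** * The Hopf-Lax function *)

Section HopfLax.
Context {R : realType} {n : nat}.
Variables H sigma : 'rV[R]_n -> R.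
Hypotheses (cH : continuous H) (sH : superlinear H).

Lemma continuous_hopf_cost (t : R) (x : 'rV[R]_n) :
  continuous sigma -> continuous (hopf_cost H sigma t x).
Proof.
move=> cs y.
have sx : {for y, continuous (fun y : 'rV[R]_n => t^-1 *: (x - y))}.
  have sub : {for y, continuous (fun y : 'rV[R]_n => x - y)}.
    exact: (cvgB (FF := nbhs_filter y) (cvg_cst (FF := nbhs_filter y) x) cvg_id).
  exact: (cvgZl_tmp (FF := nbhs_filter y) (k := t^-1) sub).
have h := @continuous_comp _ _ _ (fun y : 'rV[R]_n => t^-1 *: (x - y)) (fenchel H) y sx
  (@continuous_fenchel _ _ H cH sH _).
exact: (cvgD (FF := nbhs_filter y) (cs y)
  (cvgM (FF := nbhs_filter y) (cvg_cst (FF := nbhs_filter y) t) h)).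
Qed.

Definition hopf_minimizer (t : R) (x y : 'rV[R]_n) :=
  forall z, hopf_cost H sigma t x y <= hopf_cost H sigma t x z.

Lemma hopf_minimizerE (t : R) (x y : 'rV[R]_n) :
  hopf_minimizer t x y -> hopf_lax H sigma t x = hopf_cost H sigma t x y.
Proof. by move=> hy; apply: set_minE => [|_ [w _ <-]]; [exists y|exact: hy]. Qed.

(** The hypothesis compares the minimum over a fixed ball with the values
    outside it, for all [x] near [x0]; since the cost is continuous the minimum
    over the ball is attained, hence is a global one. *)
Lemma hopf_minimizer_locally_bounded (T t : R) (x0 : 'rV[R]_n) :
  condH1 T H sigma -> 0 < t < T ->
  exists r N : R, 0 < r /\
    forall x, enorm (x - x0) < r ->
      exists y, enorm y <= N /\ hopf_minimizer t x y.
Proof.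
move=> [cs h1] tT; have /andP[t0 t1] := tT.
have [|r [N [r0 N0 hN]]] := h1 t x0; first by rewrite ltW.
exists r, N; split => // x xr.
have [||y yN ymin] := EVT_min_rV _ (compact_eball N)
    (f := hopf_cost H sigma t x).
- by exists 0; rewrite /= enorm0 ltW.
- by apply: continuous_subspaceT; exact: continuous_hopf_cost.
rewrite inE /= in yN.
exists y; split => // z.
have [zN|Nz] := leP (enorm z) N; first by apply: ymin; rewrite inE.
apply: ltW; have := hN t x z Nz tT.
rewrite subrr normr0 add0r => /(_ xr).
rewrite (@set_minE _ _ (hopf_cost H sigma t x y))//.
  by exists y.
by move=> _ [w wN <-]; apply: ymin; rewrite inE.
Qed.

(** A minimizer for [x] competes in the minimum for [x']; as it stays in a
    fixed ball, only the Lipschitz constant of the conjugate on a bounded set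
    is involved. *)
Lemma continuous_hopf_lax (T t : R) :
  condH1 T H sigma -> 0 < t < T -> continuous (hopf_lax H sigma t).
Proof.
move=> h1 tT; have /andP[t0 t1] := tT.
apply: continuous_locally_lipschitz => x0.
have [r [N [r0 hN]]] := hopf_minimizer_locally_bounded _ _ x0 h1 tT.
have [L hL] := fenchel_lipschitz _ cH sH (t^-1 * (enorm x0 + r + N)).
have key x x' : enorm (x - x0) < r -> enorm (x' - x0) < r ->
    hopf_lax H sigma t x' - hopf_lax H sigma t x <= L * enorm (x' - x).
  move=> xr x'r.
  have [y [yN ymin]] := hN x xr.
  have [y' [_ y'min]] := hN x' x'r.
  rewrite (hopf_minimizerE _ _ _ ymin) (hopf_minimizerE _ _ _ y'min).
  have c1 := y'min y.
  have c2 : hopf_cost H sigma t x' y - hopf_cost H sigma t x y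
      <= L * enorm (x' - x).
    rewrite /hopf_cost opprD addrACA subrr add0r -mulrBr.
    (* The radius [(|x0| + r + N) / t] bounds the argument [(x' - y) / t]. *)
    rewrite -ler_pdivlMl// (le_trans (hL _ _ _))//.
      rewrite enormZ gtr0_norm ?invr_gt0// ler_pM2l ?invr_gt0//.
      rewrite (le_trans (enorm_triangle _ _))// enormN lerD//.
      by rewrite -{1}(subrKC x0 x') (le_trans (enorm_triangle _ _))// lerD2l ltW.
    rewrite -scalerBr enormZ gtr0_norm ?invr_gt0// mulrCA.
    by rewrite opprB addrA subrK.
  lra.
have x0r : enorm (x0 - x0) < r by rewrite subrr enorm0.
exists r, L; split => // x xr.
rewrite ler_norml key// andbT lerNl opprB -enormN opprB.
exact: key.
Qed.

(** The joint convexity gap of the cost, bounded below by [quadratic_gap] with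
    [a = theta / t] and evaluated at minimizers for the two end points. *)
Lemma hopf_lax_semiconvex (T t theta B : R) :
  condH1 T H sigma -> 0 < theta -> 0 < B ->
  semiconcave_with [set: 'rV[R]_n] H theta^-1 ->
  semiconvex_with [set: 'rV[R]_n] sigma B ->
  0 < t < T -> B < theta / t ->
  semiconvex_with [set: 'rV[R]_n] (hopf_lax H sigma t)
    (theta / t * B / (theta / t - B)).
Proof.
move=> h1 theta0 B0 Hsc [_ _ _ ssc] tT Bt; have /andP[t0 t1] := tT.
split.
- by move=> *; rewrite inE.
- apply: continuous_subspaceT => x.
  exact: (cvgN (FF := nbhs_filter x) (@continuous_hopf_lax T t h1 tT x)).
- by rewrite divr_gt0 ?mulr_gt0 ?invr_gt0// subr_gt0.
move=> x1 x2 l _ _ l01.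
have min x : exists y, hopf_minimizer t x y.
  have [r [N [r0 hN]]] := hopf_minimizer_locally_bounded _ _ x h1 tT.
  have [|y [_ hy]] := hN x; first by rewrite subrr enorm0.
  by exists y.
have [y1 hy1] := min x1; have [y2 hy2] := min x2.
set x := l *: x1 + (1 - l) *: x2; set y := l *: y1 + (1 - l) *: y2.
have [y0 hy0] := min x.
have := hy0 y.
rewrite (hopf_minimizerE _ _ _ hy1) (hopf_minimizerE _ _ _ hy2).
rewrite (hopf_minimizerE _ _ _ hy0) => cxy.
have sy := ssc y1 y2 l I I l01; rewrite -/y in sy.
have := fenchel_uniformly_convex _ cH sH _ theta0 Hsc
  (t^-1 *: (x1 - y1)) (t^-1 *: (x2 - y2)) _ l01.
have -> : l *: (t^-1 *: (x1 - y1)) + (1 - l) *: (t^-1 *: (x2 - y2))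
    = t^-1 *: (x - y).
  by apply/rowP => i; rewrite !mxE; ring.
have -> : t^-1 *: (x1 - y1) - t^-1 *: (x2 - y2)
    = t^-1 *: ((x1 - x2) - (y1 - y2)).
  by apply/rowP => i; rewrite !mxE; ring.
rewrite enormZ gtr0_norm ?invr_gt0// exprMn => /(ler_wpM2l (ltW t0)) fxy.
have /andP[l0 l1] := l01.
have ll : 0 <= l * (1 - l) / 2 by rewrite divr_ge0// mulr_ge0// subr_ge0.
have := ler_wpM2l ll (quadratic_gap _ _ (x1 - x2) (y1 - y2) Bt).
move: cxy; rewrite /hopf_cost.
have E : t * (l * (1 - l) * (theta / 2)
    * (t^-1 ^+ 2 * enorm (x1 - x2 - (y1 - y2)) ^+ 2))
  = l * (1 - l) / 2 * (theta / t * enorm (x1 - x2 - (y1 - y2)) ^+ 2).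
  by field; rewrite gt_eqF.
rewrite mulrDr E in fxy.
move: fxy sy.
set f0 := fenchel H (_ *: (x - y)); set f1 := fenchel H (_ *: (x1 - y1)).
set f2 := fenchel H (_ *: (x2 - y2)); set c := _ / (_ - B).
set Q := enorm (_ - _ - _) ^+ 2.
lra.
Qed.

End HopfLax.

Theorem theorem2p13 (R : realType) (n : nat) (T : R)
    (H sigma : 'rV[R]_n -> R) (theta B : R)
    (T_gt0 : 0 < T)
    (hH0 : condH0 H)
    (hH1 : condH1 T H sigma)
    (theta_gt0 : 0 < theta^-1)
    (hH : semiconcave_with [set: 'rV[R]_n] H theta^-1)
    (B_gt0 : 0 < B)
    (hsigma : semiconvex_with [set: 'rV[R]_n] sigma B) :
  exists tstar : R, 0 < tstar < T /\
    forall t0 : R, 0 < t0 < tstar ->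
      semiconvex [set: 'rV[R]_n] (fun x => hopf_lax H sigma t0 x).
Proof.
have theta0 : 0 < theta by rewrite -invr_gt0.
have [_ sH] := hH0.
have cH : continuous H.
  by have [_ cH _ _] := hH; apply/continuous_subspace_setT.
have tB0 : 0 < theta / B by exact: divr_gt0.
(* [theta / B] is the time at which the modulus [theta / t] of the kinetic
   term falls to [B]; [T / 2] keeps the bound strictly below [T]. *)
exists (Num.min (T / 2) (theta / B)); split.
  have T2 : T / 2 < T by lra.
  by rewrite lt_min tB0 divr_gt0//= gt_min T2.
move=> t /andP[t0]; rewrite lt_min => /andP[tT tB].
exists (theta / t * B / (theta / t - B)).
apply: (hopf_lax_semiconvex _ _ cH sH T) => //.
  by rewrite t0 /=; lra.
by rewrite ltr_pdivlMr// mulrC -ltr_pdivlMr.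
Qed.
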